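(* Let $N\ge 1$ and $a,b,c,d,\theta_1,\theta_2\in[0,1]$. Suppose that $$(1-\theta_1)(a+d-ab-ad)(b+c-bc-ab)=(1-\theta_2)(a+d-ad-cd)(b+c-bc-cd),$$ and that both sides of this equation are nonzero. Let $\mathcal P$ be a down-right path on the strip of width $N$ with outgoing edges $p_1,\dots,p_N\in\{\uparrow,\rightarrow\}$. Then the following product measure $\mu_{\mathcal P}$ on $\{0,1\}^N$ is a stationary measure of the six-vertex model on the strip with parameters $(a,b,c,d,\theta_1,\theta_2)$ on $\mathcal P$: the $\tau_i$ are independent, $\tau_i$ is Bernoulli with $\mathbb P(\tau_i=1)=p^\uparrow$ when $p_i=\uparrow$ and Bernoulli with $\mathbb P(\tau_i=1)=p^\rightarrow$ when $p_i=\rightarrow$, where $$p^\uparrow=\frac{a+d-ab-ad}{a+b+c+d-(a+c)(b+d)},\qquad p^\rightarrow=\frac{a+d-ad-cd}{a+b+c+d-(a+c)(b+d)}.$$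
   Context: Strip and paths. Fix an integer $N\ge 1$. The strip of width $N$ is $\{(x,y)\in\mathbb Z^2: 0\le y\le x\le y+N\}$, with an edge between any two of its vertices at distance 1; each edge can carry at most one (up or right) arrow. Vertices $(y,y)$ are left boundary vertices, $(y+N,y)$ are right boundary vertices, all others are bulk vertices. The left/bottom edges at a vertex (those lying in the strip) are its incoming edges, the right/top ones its outgoing edges. Thus a left boundary vertex has at most a bottom incoming edge and a right outgoing edge; a right boundary vertex has a left incoming edge and a top outgoing edge. A down-right path $\mathcal P$ is a path in the strip from a left boundary vertex to a right boundary vertex with each step going down or right by 1 (so it has $N$ steps). Its outgoing edges are the edges going up or right from a vertex of $\mathcal P$ to a vertex not on $\mathcal P$; there are exactly $N$, labelled $p_1,\dots,p_N$ from up-left to down-right ($p_i$ is the unique one joining the lines $x-y=i-1$ and $x-y=i$); we write $p_i=\uparrow$ if this edge is vertical and $p_i=\rightarrow$ if it is horizontal. An outgoing configuration of $\mathcal P$ is $\tau=(\tau_1,\dots,\tau_N)\in\{0,1\}^N$, $\tau_i=1$ iff $p_i$ carries an arrow. Six-vertex dynamics. Let $\mathcal Q$ be a down-right path lying (weakly) above $\mathcal P$. Given an outgoing configuration of $\mathcal P$, sample sequentially the outgoing edges of all vertices between $\mathcal P$ and $\mathcal Q$, including those on $\mathcal Q$ and excluding those on $\mathcal P$, in order of increasing $y$ and, for equal $y$, increasing $x$, independently given the incoming edges, as follows. Bulk vertex: if both (resp. neither) incoming edges carry arrows, both (resp. neither) outgoing edges do; if only the left incoming edge carries an arrow, it exits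 to the right with probability $\theta_2$ and to the top with probability $1-\theta_2$; if only the bottom incoming edge carries an arrow, it exits to the top with probability $\theta_1$ and to the right with probability $1-\theta_1$. Left boundary vertex: if the bottom edge carries an arrow, the right edge carries one with probability $1-c$ (none with probability $c$); if the bottom edge is empty, the right edge carries an arrow with probability $a$ (none with probability $1-a$). Right boundary vertex: if the left edge carries an arrow, the top edge carries one with probability $1-b$ (none with probability $b$); if the left edge is empty, the top edge carries an arrow with probability $d$ (none with probability $1-d$). This defines a transition matrix $P_{\mathcal P,\mathcal Q}(\tau,\tau')$ from outgoing configurations of $\mathcal P$ to those of $\mathcal Q$. Particle system on $\mathcal P$. Let $\mathcal P_k=\mathcal P+(k,k)$. The interacting particle system of the six-vertex model on the strip on $\mathcal P$ is the time-homogeneous Markov chain on $\{0,1\}^N$ with transition matrix $P_{\mathcal P_k,\mathcal P_{k+1}}=P_{\mathcal P,\mathcal P_1}$. A stationary measure of this chain is called a stationary measure of the six-vertex model on a strip on $\mathcal P$ (it need not be unique here). *)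

(* Defs.v *)
From HB Require Import structures.
From mathcomp Require Import all_boot all_order all_algebra.
Set Implicit Arguments.
Unset Strict Implicit.
Unset Printing Implicit Defensive.
Import Order.TTheory GRing.Theory Num.Theory.
Local Open Scope ring_scope.

(* The strip lies in y >= 0, so its vertices (x, y) have natural coordinates. *)
Definition vertex := (nat * nat)%type.

Definition in_strip (N : nat) (v : vertex) : bool := (v.2 <= v.1 <= v.2 + N)%N.
Definition left_bdry (v : vertex) : bool := v.1 == v.2.
Definition right_bdry (N : nat) (v : vertex) : bool := v.1 == (v.2 + N)%N.

(* An edge is the pair (source, target); its target is one unit above or to
   the right of its source. *)
Definition edge := (vertex * vertex)%type.

Definition up_edge (v : vertex) : edge := (v, (v.1, v.2.+1)).
Definition right_edge (v : vertex) : edge := (v, (v.1.+1, v.2)).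
(* For a zero coordinate these are not edges; they are never read there when
   the vertex lies strictly above a down-right path. *)
Definition bottom_edge (v : vertex) : edge := ((v.1, v.2.-1), v).
Definition left_edge (v : vertex) : edge := ((v.1.-1, v.2), v).

Definition vertical (e : edge) : bool := e.1.1 == e.2.1.

Definition down_right_step (u v : vertex) : bool :=
  (v == (u.1.+1, u.2)) || (u == (v.1, v.2.+1)).

Definition down_right_path (N : nat) (P : seq vertex) : bool :=
  if P is u :: s then
    [&& all (in_strip N) P, left_bdry u, path down_right_step u s
      & right_bdry N (last u s)]
  else false.

(* The index of the line x - y = k through a vertex of the strip (where the
   truncated subtraction is exact). *)
Definition diag (v : vertex) : nat := (v.1 - v.2)%N.

(* Listed from up-left to down-right: the up edge of a vertex on the line
   x - y = k joins the lines k - 1 and k, its right edge the lines k and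
   k + 1.  There are N of them when P is a down-right path. *)
Definition out_edges (N : nat) (P : seq vertex) : seq edge :=
  [seq e <- flatten [seq [:: up_edge v; right_edge v] | v <- P]
     | in_strip N e.2 && (e.2 \notin P)].

(* p_(i+1): indices start at 0 here. *)
Definition out_edge (N : nat) (P : seq vertex) (i : 'I_N) : edge :=
  nth ((0, 0), (0, 0))%N (out_edges N P) i.

Definition shift (k : nat) (P : seq vertex) : seq vertex :=
  [seq ((v.1 + k)%N, (v.2 + k)%N) | v <- P].

(* A down-right path meets each line x - y = k, 0 <= k <= N, exactly once. *)
Definition strictly_above (P : seq vertex) (v : vertex) : bool :=
  has (fun u => (diag u == diag v) && (u.2 < v.2)%N) P.
Definition weakly_below (Q : seq vertex) (v : vertex) : bool :=
  has (fun w => (diag w == diag v) && (v.2 <= w.2)%N) Q.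

(* In order of increasing y and, for equal y, increasing x. *)
Definition between (N : nat) (P Q : seq vertex) : seq vertex :=
  [seq v <- [seq (x, y) | y <- iota 0 (\max_(w <- Q) w.2).+1,
                          x <- iota y N.+1]
     | strictly_above P v && weakly_below Q v].

Definition bernoulli (R : realFieldType) (p : R) (x : bool) : R :=
  if x then p else 1 - p.

(* Probability that the (right, top) outgoing edges carry (r, t), given that
   the (left, bottom) incoming edges carry (l, bt). *)
Definition bulk_weight (R : realFieldType) (theta1 theta2 : R)
    (l bt r t : bool) : R :=
  match l, bt with
  | true, true => (r && t)%:R
  | false, false => (~~ r && ~~ t)%:R
  | true, false => if r == t then 0 else bernoulli theta2 r
  | false, true => if r == t then 0 else bernoulli theta1 t
  end.

(* A boundary vertex has a single outgoing edge; the missing one is treated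
   as an edge without arrow. *)
Definition vertex_weight (R : realFieldType) (N : nat)
    (a b c d theta1 theta2 : R) (v : vertex) (l bt r t : bool) : R :=
  if left_bdry v then
    if t then 0 else bernoulli (if bt then 1 - c else a) r
  else if right_bdry N v then
    if r then 0 else bernoulli (if l then 1 - b else d) t
  else bulk_weight theta1 theta2 l bt r t.

Definition arrows := edge -> bool.

Definition set_out (w : arrows) (v : vertex) (r t : bool) : arrows :=
  fun e => if e == right_edge v then r else if e == up_edge v then t else w e.

(* Probability that the arrows satisfy A once the outgoing edges of the
   vertices in vs have been sampled one vertex after the other, starting
   from the arrows w. *)
Fixpoint prob_after (R : realFieldType) (N : nat)
    (a b c d theta1 theta2 : R) (vs : seq vertex) (w : arrows)
    (A : pred arrows) : R :=
  if vs is v :: vs' then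
    \sum_(r : bool) \sum_(t : bool)
      vertex_weight N a b c d theta1 theta2 v
        (w (left_edge v)) (w (bottom_edge v)) r t *
      prob_after N a b c d theta1 theta2 vs' (set_out w v r t) A
  else (A w)%:R.

Definition out_config (N : nat) := {ffun 'I_N -> bool}.

Definition init_arrows (N : nat) (P : seq vertex) (tau : out_config N) : arrows :=
  fun e => [exists i, (e == out_edge P i) && tau i].

Definition has_out_config (N : nat) (Q : seq vertex) (tau : out_config N) :
    pred arrows :=
  fun w => [forall i, w (out_edge Q i) == tau i].

Definition transition (R : realFieldType) (N : nat)
    (a b c d theta1 theta2 : R) (P Q : seq vertex)
    (tau tau' : out_config N) : R :=
  prob_after N a b c d theta1 theta2 (between N P Q) (init_arrows P tau)
    (has_out_config Q tau').

Definition stationary (R : realFieldType) (T : finType) (K : T -> T -> R)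
    (mu : T -> R) : Prop :=
  [/\ forall x, 0 <= mu x,
      \sum_x mu x = 1
    & forall y, \sum_x mu x * K x y = mu y].

Definition six_vertex_stationary (R : realFieldType) (N : nat)
    (a b c d theta1 theta2 : R) (P : seq vertex) (mu : out_config N -> R) : Prop :=
  stationary (transition a b c d theta1 theta2 P (shift 1 P)) mu.

(* The law of independent tau_i, with tau_i Bernoulli of parameter pup when
   the i-th outgoing edge is vertical and pright when it is horizontal. *)
Definition product_measure (R : realFieldType) (N : nat) (pup pright : R)
    (P : seq vertex) (tau : out_config N) : R :=
  \prod_(i < N)
    bernoulli (if vertical (out_edge P i) then pup else pright) (tau i).

(* Main.v *)
Require Import Defs.
From Stdlib Require Import FunctionalExtensionality.
From mathcomp Require Import all_boot all_order all_algebra.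
From mathcomp Require Import zify ring.
Set Implicit Arguments.
Unset Strict Implicit.
Unset Printing Implicit Defensive.
Import Order.TTheory GRing.Theory Num.Theory.
Local Open Scope ring_scope.

(** Give every edge of the strip an independent arrow, with parameter pup on
    vertical edges and pright on horizontal ones.  The two formulas for pup and
    pright, together with the equation between the parameters, ensure that each
    vertex maps the product law of its incoming edges to the product law of its
    outgoing edges ([vertex_balance]).  Hence sampling a vertex anew
    does not change the law seen by anything that ignores the incoming edges
    of that vertex ([average_seq_sample]), and this remains true after the
    vertices between the path P and its translate Q have all been sampled
    ([average_seq_prob]).

    To avoid following the current frontier of the sampling, the argument
    works with functions of all arrows and with operators [average p e] that
    integrate out the arrow of one edge.  These operators are idempotent and
    commute, and [average p e] fixes the functions that do not look at e, so
    integrating over a list of edges depends on the list only through the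
    edges that the function looks at ([eq_average_seq]).  Let A be the event
    that Q has a given outgoing configuration, and G the probability that the
    dynamics produces A, as a function of the initial arrows.  Then
    - the sum over tau of mu(tau) K(tau, tau') is the average of G over the
      outgoing edges of P ([sum_init_arrows]);
    - it is also the average of G over all the edges around the vertices of Q,
      because an edge that is read by the dynamics and does not leave P leaves
      a vertex sampled earlier, so that its initial arrow is overwritten
      ([read_edge_source], [indep_prob_written]);
    - by the balance at each vertex this is the average of A over the same
      edges, which is mu(tau') as A looks only at the outgoing edges of Q.

    Down-right paths are described by the height of their vertex on each line
    x - y = k.  This makes the outgoing edges explicit, shows that P and its
    translate have the same sequence of edge directions, and identifies the
    vertices between the two paths with those of Q. *)

(** * Averaging over the arrow of one edge *)

Definition set_edge (w : arrows) (e : edge) (x : bool) : arrows :=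
  fun e' => if e' == e then x else w e'.

Definition indep (T : Type) (e : edge) (F : arrows -> T) : Prop :=
  forall w x, F (set_edge w e x) = F w.

Lemma set_edgeC (w : arrows) (e f : edge) (x y : bool) : e != f ->
  set_edge (set_edge w e x) f y = set_edge (set_edge w f y) e x.
Proof.
move=> nef; apply: functional_extensionality => g; rewrite /set_edge.
by have [->|//] := eqVneq g f; rewrite eq_sym (negbTE nef).
Qed.

Lemma set_edge_twice (w : arrows) (e : edge) (x y : bool) :
  set_edge (set_edge w e x) e y = set_edge w e y.
Proof.
by apply: functional_extensionality => g; rewrite /set_edge; case: eqP.
Qed.

Lemma eq_off_indep (T : Type) (L : seq edge) (F : arrows -> T) (w w' : arrows) :
  {in L, forall e, indep e F} -> (forall e, e \notin L -> w e = w' e) ->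
  F w = F w'.
Proof.
elim: L w => [|e L IHL] w indF eqw.
  by congr F; apply: functional_extensionality => e; apply: eqw.
rewrite -(indF e (mem_head _ _) w (w' e)); apply: IHL => [f fL|f fL].
  by apply: indF; rewrite inE fL orbT.
by rewrite /set_edge; have [->//|nef] := eqVneq f e; rewrite eqw // inE negb_or nef.
Qed.

Lemma sum_bernoulli (R : realFieldType) (p : R) : \sum_(x : bool) bernoulli p x = 1.
Proof. by rewrite big_bool /= addrC subrK. Qed.

Definition average (R : realFieldType) (p : edge -> R) (e : edge)
    (F : arrows -> R) : arrows -> R :=
  fun w => \sum_(x : bool) bernoulli (p e) x * F (set_edge w e x).

Definition average_seq (R : realFieldType) (p : edge -> R) (L : seq edge)
    (F : arrows -> R) : arrows -> R :=
  foldr (average p) F L.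

Section Average.
Variables (R : realFieldType) (p : edge -> R).
Implicit Types (e f : edge) (L M : seq edge) (F : arrows -> R).

Lemma average_indep e F : indep e F -> average p e F = F.
Proof.
move=> indF; apply: functional_extensionality => w; rewrite /average.
by under eq_bigr do rewrite indF; rewrite -big_distrl /= sum_bernoulli mul1r.
Qed.

Lemma indep_average e F : indep e (average p e F).
Proof. by move=> w x; rewrite /average; under eq_bigr do rewrite set_edge_twice. Qed.

Lemma averageC e f F : average p e (average p f F) = average p f (average p e F).
Proof.
have [-> //|nef] := eqVneq e f.
apply: functional_extensionality => w; rewrite /average.
under eq_bigr do rewrite big_distrr /=.
rewrite exchange_big; apply: eq_bigr => y _; rewrite big_distrr /=.
by apply: eq_bigr => x _; rewrite mulrCA set_edgeC.
Qed.

Lemma average_seqC e L F :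
  average_seq p L (average p e F) = average p e (average_seq p L F).
Proof. by elim: L => //= f L ->; rewrite averageC. Qed.

Lemma average_seq_absorb e L F : e \in L ->
  average_seq p L (average p e F) = average_seq p L F.
Proof.
elim: L => //= f L IHL; rewrite inE => /predU1P[->|/IHL -> //].
by rewrite average_seqC (average_indep (indep_average _ _)).
Qed.

(** An edge of M either is averaged already in L, or does not matter to F; the
    commutation of the averages brings it next to the one or the other. *)
Lemma average_seq_cat_absorb L M F :
  {in M, forall e, e \notin L -> indep e F} ->
  average_seq p (L ++ M) F = average_seq p L F.
Proof.
rewrite /average_seq foldr_cat -/(average_seq _ _ _) -/(average_seq _ _ _).
elim: M => //= e M IHM indF.
have {}IHM : average_seq p L (average_seq p M F) = average_seq p L F.
  by apply: IHM => f fM; apply: indF; rewrite inE fM orbT.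
have [eL|neL] := boolP (e \in L); first by rewrite average_seq_absorb.
by rewrite -average_seqC (average_indep (indF e (mem_head _ _) neL)).
Qed.

Lemma indep_average_seq e L F : e \in L -> indep e (average_seq p L F).
Proof.
by move=> eL; rewrite -(average_seq_absorb F eL) average_seqC; apply: indep_average.
Qed.

Lemma average_seq_catC L M F :
  average_seq p (L ++ M) F = average_seq p (M ++ L) F.
Proof.
rewrite /average_seq !foldr_cat -!/(average_seq _ _ _).
by elim: L => //= e L ->; rewrite average_seqC.
Qed.

(** Edges that belong to only one of the lists are integrated out to no effect,
    and repetitions are harmless because averaging is idempotent. *)
Lemma eq_average_seq L M F :
  {in L, forall e, e \notin M -> indep e F} ->
  {in M, forall e, e \notin L -> indep e F} ->
  average_seq p L F = average_seq p M F.
Proof.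
move=> indL indM.
by rewrite -(average_seq_cat_absorb indM) average_seq_catC average_seq_cat_absorb.
Qed.

End Average.

(** * Averaging over independent arrows on finitely many edges *)

Section ProductLaw.
Variables (R : realFieldType) (N : nat).
Implicit Types (tau : out_config N) (q : 'I_N -> R).

Definition set_coord tau (i : 'I_N) (x : bool) : out_config N :=
  [ffun j => if j == i then x else tau j].

Lemma sum_prod_bernoulli q :
  \sum_(tau : out_config N) \prod_(i < N) bernoulli (q i) (tau i) = 1.
Proof.
rewrite -(bigA_distr_bigA (fun i x => bernoulli (q i) x)) big1 // => i _.
exact: sum_bernoulli.
Qed.

(** Resampling one coordinate preserves the product law: exchanging the old and
    the new value of that coordinate is an involution of the pairs
    (configuration, new value), and it preserves their joint weight. *)
Lemma resample_coord q (i : 'I_N) (g : out_config N -> R) :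
  \sum_(tau : out_config N) (\prod_(j < N) bernoulli (q j) (tau j)) *
    \sum_(x : bool) bernoulli (q i) x * g (set_coord tau i x) =
  \sum_(tau : out_config N) (\prod_(j < N) bernoulli (q j) (tau j)) * g tau.
Proof.
pose swap (u : out_config N * bool) := (set_coord u.1 i u.2, u.1 i).
have swapK : involutive swap.
  move=> [tau x]; rewrite /swap /= !ffunE eqxx; congr (_, _).
  by apply/ffunP => j; rewrite !ffunE; case: eqP => // ->.
under eq_bigr do rewrite big_distrr /=.
rewrite pair_bigA /= (reindex_inj (inv_inj swapK)) /=.
rewrite -(pair_bigA _ (fun tau x =>
  (\prod_(j < N) bernoulli (q j) (set_coord tau i x j)) *
  (bernoulli (q i) (tau i) * g (set_coord (set_coord tau i x) i (tau i))))) /=.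
apply: eq_bigr => tau _.
rewrite -[RHS]mul1r -(sum_bernoulli (q i)) big_distrl /=; apply: eq_bigr => x _.
rewrite (_ : set_coord (set_coord tau i x) i (tau i) = tau); last first.
  by apply/ffunP => j; rewrite !ffunE; case: eqP => // ->.
rewrite (bigD1 i) //= [in RHS](bigD1 i) //= ffunE eqxx.
under eq_bigr => j /negbTE nji do rewrite ffunE nji.
ring.
Qed.

(** Resampling the coordinates one after the other turns F into its average
    over all the outgoing edges.  That average no longer depends on the
    configuration, whose weights sum to 1. *)
Lemma sum_init_arrows (p : edge -> R) (P : seq vertex) (F : arrows -> R) :
  injective (@out_edge N P) ->
  \sum_(tau : out_config N) (\prod_(i < N) bernoulli (p (out_edge P i)) (tau i)) *
     F (init_arrows P tau) =
  average_seq p [seq out_edge P i | i <- enum 'I_N] F (fun=> false).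
Proof.
move=> inj_out; pose mu (tau : out_config N) :=
  \prod_(i < N) bernoulli (p (out_edge P i)) (tau i).
have init_out tau i x :
    set_edge (init_arrows P tau) (out_edge P i) x =
    init_arrows P (set_coord tau i x).
  apply: functional_extensionality => e; rewrite /set_edge /init_arrows.
  have [->|ne] := eqVneq e (out_edge P i).
    apply/idP/existsP => [xT|[j /andP[/eqP/inj_out <-]]]; last by rewrite ffunE eqxx.
    by exists i; rewrite ffunE !eqxx.
  apply: eq_existsb => j; rewrite ffunE; case: eqP => //= ej.
  by case: eqP => // ji; rewrite ej ji eqxx in ne.
transitivity (\sum_(tau : out_config N) mu tau *
    average_seq p [seq out_edge P i | i <- enum 'I_N] F (init_arrows P tau)).
  elim: (enum 'I_N) => //= i s ->; rewrite -(resample_coord _ i).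
  apply: eq_bigr => tau _; congr (_ * _).
  by rewrite /average; apply: eq_bigr => x _; rewrite init_out.
rewrite -[RHS]mul1r -(sum_prod_bernoulli (fun i => p (out_edge P i))) big_distrl /=.
apply: eq_bigr => tau _; congr (_ * _).
apply: (@eq_off_indep _ [seq out_edge P i | i <- enum 'I_N]) => [e|e eNP].
  exact: indep_average_seq.
rewrite /init_arrows; apply/existsP => -[i /andP[/eqP ei _]].
by rewrite ei map_f ?mem_enum in eNP.
Qed.

End ProductLaw.

(** * Sampling the outgoing edges of one vertex *)

(** The edges on which the law of the outgoing edges of v depends.  The missing
    incoming edge of a boundary vertex is excluded: it would otherwise be an
    edge that is read without leaving the path or a sampled vertex. *)
Definition reads (N : nat) (v : vertex) (e : edge) : bool :=
  (e == left_edge v) && ~~ left_bdry v || (e == bottom_edge v) && ~~ right_bdry N v.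

Definition scan_order (u v : vertex) : bool :=
  (u.2 < v.2)%N || (u.2 == v.2) && (u.1 < v.1)%N.

Lemma scan_order_irr : irreflexive scan_order.
Proof. by move=> v; rewrite /scan_order !ltnn andbF. Qed.

Lemma reads_target N v e : reads N v e -> e.2 = v.
Proof. by case/orP => /andP[/eqP-> _]. Qed.

Lemma out_edge_scan_order v e :
  e \in [:: right_edge v; up_edge v] -> scan_order v e.2.
Proof. by rewrite !inE /scan_order => /orP[] /eqP->/=; rewrite ?ltnSn ?eqxx ?orbT. Qed.

Lemma right_edge_neq_up v : right_edge v != up_edge v.
Proof. by apply/eqP => -[/eqP]; rewrite gtn_eqF. Qed.

Section Dynamics.
Variables (R : realFieldType) (N : nat) (a b c d theta1 theta2 : R).
Hypothesis N_gt0 : (0 < N)%N.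
Implicit Types (v : vertex) (vs : seq vertex) (e : edge) (w : arrows)
  (F : arrows -> R) (A : pred arrows).

Local Notation weight := (vertex_weight N a b c d theta1 theta2).
Local Notation prob vs A := (fun w => prob_after N a b c d theta1 theta2 vs w A).

Definition sample v F : arrows -> R := fun w =>
  \sum_(r : bool) \sum_(t : bool)
    weight v (w (left_edge v)) (w (bottom_edge v)) r t * F (set_out w v r t).

Lemma left_not_right_bdry v : left_bdry v -> right_bdry N v = false.
Proof. by rewrite /left_bdry /right_bdry; lia. Qed.

Lemma prob_after_cons v vs A : prob (v :: vs) A = sample v (prob vs A).
Proof. by []. Qed.

Lemma indep_set_out v e F r t :
  e \in [:: right_edge v; up_edge v] \/ indep e F ->
  indep e (fun w => F (set_out w v r t)).
Proof.
have outE w : set_out w v r t =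
  set_edge (set_edge w (up_edge v) t) (right_edge v) r by [].
move=> eF w x; rewrite !outE.
have [->|ner] := eqVneq e (right_edge v).
  by rewrite (set_edgeC w x t (right_edge_neq_up v)) set_edge_twice.
have [->|neu] := eqVneq e (up_edge v); first by rewrite set_edge_twice.
rewrite (set_edgeC w x t neu) (set_edgeC _ x r ner).
by case: eF => [|->//]; rewrite !inE (negbTE ner) (negbTE neu).
Qed.

Lemma indep_sample v e F : ~~ reads N v e ->
  e \in [:: right_edge v; up_edge v] \/ indep e F -> indep e (sample v F).
Proof.
move=> unread eF w x; rewrite /sample.
apply: eq_bigr => r _; apply: eq_bigr => t _; congr (_ * _); last first.
  exact: (indep_set_out r t eF).
move: unread; rewrite /reads /vertex_weight.
have keep f : e != f -> set_edge w e x f = w f.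
  by rewrite /set_edge eq_sym => /negbTE ->.
have [lv|nlv] := boolP (left_bdry v).
  by rewrite (left_not_right_bdry lv) andbF andbT => /keep ->.
have [rv|nrv] := boolP (right_bdry N v).
  by rewrite andbT andbF orbF => /keep ->.
by rewrite !andbT => /norP[/keep -> /keep ->].
Qed.

Lemma indep_prob_unread vs A e :
  {in vs, forall v, ~~ reads N v e} -> indep e (fun w => (A w)%:R : R) ->
  indep e (prob vs A).
Proof.
move=> + indA; elim: vs => [//|v vs IHvs] unread.
rewrite prob_after_cons; apply: indep_sample; first exact/unread/mem_head.
by right; apply: IHvs => u u_vs; apply: unread; rewrite inE u_vs orbT.
Qed.

(** In the scanning order an edge ends after the vertex that it leaves, so no
    vertex reads it before v is sampled and overwrites it. *)
Lemma indep_prob_written vs A v e :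
  pairwise scan_order vs -> v \in vs -> e \in [:: right_edge v; up_edge v] ->
  indep e (prob vs A).
Proof.
move=> + + ev; elim: vs => [//|u vs IHvs] /= /andP[u_vs ord_vs] v_uvs.
rewrite prob_after_cons; apply: indep_sample; last first.
  by move: v_uvs; rewrite inE => /predU1P[<-|/(IHvs ord_vs)]; [left | right].
apply/negP => /reads_target eu; have := out_edge_scan_order ev; rewrite eu.
move: v_uvs; rewrite inE => /predU1P[->|/(allP u_vs)]; first by rewrite scan_order_irr.
by rewrite /scan_order; lia.
Qed.

(** * The product measure is preserved at each vertex *)

Variables (pup pright : R).
Hypothesis bulk_balance :
  (1 - theta1) * (pup * (1 - pright)) = (1 - theta2) * (pright * (1 - pup)).
Hypothesis left_balance : pright = pup * (1 - c) + (1 - pup) * a.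
Hypothesis right_balance : pup = pright * (1 - b) + (1 - pright) * d.

(** The value 0 outside the strip accounts for the missing outgoing edge of a
    boundary vertex, whose arrow is set to false.  Thus boundary vertices obey
    the same balance equation as bulk vertices. *)
Definition edge_prob e : R :=
  if in_strip N e.2 then if vertical e then pup else pright else 0.

(** At a bulk vertex only the two cases with a single outgoing arrow need an
    argument, and there the total probability of a single incoming arrow is split
    correctly by [bulk_balance].  The incoming edge that a boundary vertex
    ignores sums to 1. *)
Lemma vertex_balance v r t : in_strip N v -> (0 < v.2)%N ->
  \sum_(l : bool) \sum_(bt : bool)
    bernoulli (edge_prob (left_edge v)) l *
    bernoulli (edge_prob (bottom_edge v)) bt * weight v l bt r t =
  bernoulli (edge_prob (right_edge v)) r * bernoulli (edge_prob (up_edge v)) t.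
Proof.
case: v => x y /=; rewrite /in_strip /= => /andP[le_yx le_xyN] y_gt0.
have -> : edge_prob (left_edge (x, y)) = pright.
  by rewrite /edge_prob /in_strip /vertical /= le_yx le_xyN ifF //; lia.
have -> : edge_prob (bottom_edge (x, y)) = pup.
  by rewrite /edge_prob /in_strip /vertical /= le_yx le_xyN eqxx.
have -> : edge_prob (right_edge (x, y)) = if right_bdry N (x, y) then 0 else pright.
  rewrite /edge_prob /in_strip /right_bdry /vertical /=; case: (eqVneq x (y + N)%N).
    by move=> ->; rewrite ltnn andbF.
  by move=> nxyN; rewrite (ltn_eqF (ltnSn x)) ifT //; lia.
have -> : edge_prob (up_edge (x, y)) = if left_bdry (x, y) then 0 else pup.
  rewrite /edge_prob /in_strip /left_bdry /vertical /= eqxx; case: (eqVneq x y).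
    by move=> ->; rewrite ltnn.
  by move=> nxy; rewrite ifT //; lia.
rewrite /vertex_weight; have [xy|nxy] := boolP (left_bdry (x, y)).
  rewrite (left_not_right_bdry xy) !big_bool left_balance; case: t; case: r => /=; ring.
have [xyN|nxyN] := boolP (right_bdry N (x, y)).
  rewrite !big_bool right_balance; case: t; case: r => /=; ring.
(* With a single outgoing arrow, the two sides of the goal differ by the
   difference of the two sides of [bulk_balance]. *)
rewrite !big_bool; case: t; case: r => /=; [ring| | |ring].
  by rewrite -[RHS]addr0 -(subrr ((1 - theta1) * (pup * (1 - pright))))
    {1}bulk_balance; ring.
by rewrite -[RHS]addr0 -(subrr ((1 - theta1) * (pup * (1 - pright))))
    {2}bulk_balance; ring.
Qed.

(** Integrate first over the incoming edges of v, which F ignores: by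
    [vertex_balance] what is left is the average of F over the outgoing
    edges of v, and these are in L as well. *)
Lemma average_seq_sample L v F :
  in_strip N v -> (0 < v.2)%N ->
  {subset [:: left_edge v; bottom_edge v; right_edge v; up_edge v] <= L} ->
  indep (left_edge v) F -> indep (bottom_edge v) F ->
  average_seq edge_prob L (sample v F) = average_seq edge_prob L F.
Proof.
move=> v_strip v_gt0 sub_L indl indb.
have [lL bL rL uL] : [/\ left_edge v \in L, bottom_edge v \in L,
    right_edge v \in L & up_edge v \in L].
  by split; apply: sub_L; rewrite !inE eqxx ?orbT.
rewrite -(average_seq_absorb _ _ lL) -(average_seq_absorb _ _ bL).
rewrite -[RHS](average_seq_absorb _ _ uL) -[RHS](average_seq_absorb _ _ rL).
rewrite averageC [in RHS]averageC; congr average_seq.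
apply: functional_extensionality => w; rewrite /average.
pose Z r t := F (set_out w v r t).
transitivity (\sum_(l : bool) \sum_(bt : bool) \sum_(r : bool) \sum_(t : bool)
  bernoulli (edge_prob (left_edge v)) l *
    bernoulli (edge_prob (bottom_edge v)) bt * weight v l bt r t * Z r t).
  apply: eq_bigr => l _; rewrite big_distrr; apply: eq_bigr => bt _ /=.
  rewrite mulrA /sample big_distrr /=; apply: eq_bigr => r _.
  rewrite big_distrr /=; apply: eq_bigr => t _.
  rewrite -!mulrA; congr (_ * (_ * (_ * _))); last first.
    by rewrite (indep_set_out r t (or_intror indb)) (indep_set_out r t (or_intror indl)).
  have lb : left_edge v != bottom_edge v.
    apply/eqP => -[]; case: v v_strip v_gt0 {sub_L indl indb lL bL rL uL Z}.
    by rewrite /in_strip => x y /=; lia.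
  by congr (_ _ _ _ _); rewrite /set_edge ?eqxx // (negbTE lb).
transitivity (\sum_(r : bool) \sum_(t : bool)
    (\sum_(l : bool) \sum_(bt : bool)
      bernoulli (edge_prob (left_edge v)) l *
      bernoulli (edge_prob (bottom_edge v)) bt * weight v l bt r t) * Z r t).
  by rewrite !big_bool /=; ring.
rewrite exchange_big; apply: eq_bigr => t _; rewrite big_distrr.
by apply: eq_bigr => r _; rewrite /= vertex_balance // mulrCA mulrA.
Qed.

(** Remove the vertices from the list one at a time, starting with the first.
    Edges ending at v are read by no later vertex, because such edges are read
    at v only, and v occurs once. *)
Lemma average_seq_prob L vs A :
  {in vs, forall v, in_strip N v && (0 < v.2)%N} ->
  {in vs, forall v,
    {subset [:: left_edge v; bottom_edge v; right_edge v; up_edge v] <= L}} ->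
  uniq vs -> (forall e, e.2 \in vs -> indep e (fun w => (A w)%:R : R)) ->
  average_seq edge_prob L (prob vs A) = average_seq edge_prob L (fun w => (A w)%:R).
Proof.
elim: vs => [//|v vs IHvs] strip_vs sub_L /= /andP[v_vs uniq_vs] indA.
have vv : v \in v :: vs := mem_head _ _.
have /andP[v_strip v_gt0] := strip_vs v vv.
(* Later vertices read only edges that end at themselves. *)
have ind_in e : e.2 = v -> indep e (prob vs A).
  move=> ev; apply: indep_prob_unread => [u u_vs|]; last by apply: indA; rewrite ev.
  by apply/negP => /reads_target eu; rewrite -ev eu u_vs in v_vs.
rewrite prob_after_cons average_seq_sample //;
  [|exact: sub_L|exact: ind_in|exact: ind_in].
apply: IHvs => // [u u_vs|u u_vs|e e_vs].
- by apply: strip_vs; rewrite inE u_vs orbT.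
- by apply: sub_L; rewrite inE u_vs orbT.
- by apply: indA; rewrite inE e_vs orbT.
Qed.

End Dynamics.

(** * Down-right paths as height functions *)

Definition height_vertex (h : nat -> nat) (k : nat) : vertex := ((h k + k)%N, h k).

Definition height_path (N : nat) (h : nat -> nat) : seq vertex :=
  mkseq (height_vertex h) N.+1.

Definition down_right_height (N : nat) (h : nat -> nat) : Prop :=
  forall k, (k < N)%N -> h k = h k.+1 \/ h k = (h k.+1).+1.

Definition height_out_edge (h : nat -> nat) (k : nat) : edge :=
  if h k == h k.+1 then up_edge (height_vertex h k.+1)
  else right_edge (height_vertex h k).

(** Every step, right or down, increases x - y by one, so the k-th vertex of the
    path lies on the line x - y = k and is determined by its height. *)
Lemma down_right_path_height N P : down_right_path N P ->
  exists2 h, down_right_height N h & P = height_path N h.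
Proof.
case: P => [//|u s] /and4P[_ /eqP u_left /(pathP u) steps /eqP last_right].
pose g k := nth u (u :: s) k.
have stepE k : (k < size s)%N ->
    g k.+1 = ((g k).1.+1, (g k).2) \/ g k = ((g k.+1).1, (g k.+1).2.+1).
  by move=> /steps; rewrite -[nth u s k]/(g k.+1) => /orP[] /eqP; [left|right].
have xE k : (k <= size s)%N -> (g k).1 = ((g k).2 + k)%N.
  elim: k => [|k IHk] k_s; first by rewrite addn0.
  by move: (IHk (ltnW k_s)); case: (stepE k k_s) => -> /=; lia.
have sizeE : size s = N.
  have := xE _ (leqnn _); rewrite /g nth_last /= last_right => /eqP.
  by rewrite eqn_add2l => /eqP.
exists (fun k => (g k).2) => [k|].
  by rewrite -sizeE => /stepE[] ->; [left|right].
apply: (@eq_from_nth _ u) => [|k]; first by rewrite size_mkseq /= sizeE.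
move=> /= k_s; rewrite nth_mkseq ?sizeE -?sizeE // /height_vertex -xE //.
by rewrite /g; case: (nth _ _ _).
Qed.

Section Heights.
Variables (N : nat) (h : nat -> nat).
Hypothesis h_down : down_right_height N h.

Lemma shift_height_path : shift 1 (height_path N h) = height_path N (fun k => (h k).+1).
Proof.
rewrite /shift /height_path /mkseq -map_comp; apply: eq_map => k /=.
by rewrite /height_vertex !addn1 addSn.
Qed.

Lemma mem_height_path v :
  (v \in height_path N h) = in_strip N v && (v.2 == h (diag v)).
Proof.
rewrite /height_path /mkseq; apply/mapP/idP => [[k]|].
  rewrite mem_iota add0n => /andP[_ k_N] ->; rewrite /in_strip /diag /=.
  by rewrite addKn eqxx leq_addr leq_add2l -ltnS k_N.
case: v => x y; rewrite /in_strip /diag /= => /andP[/andP[yx xyN] /eqP yh].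
exists (x - y)%N; first by rewrite -/(iota 0 N.+1) mem_iota; lia.
by rewrite /height_vertex -yh subnKC.
Qed.

(** A path has exactly one vertex on each line x - y = k, so that comparing v
    with the path amounts to comparing v with that vertex. *)
Lemma has_height_path (a : pred nat) v : in_strip N v ->
  has (fun u => (diag u == diag v) && a u.2) (height_path N h) = a (h (diag v)).
Proof.
move=> v_strip; apply/hasP/idP => [[u]|a_h].
  by rewrite mem_height_path => /andP[_ /eqP ->] /andP[/eqP ->].
exists (height_vertex h (diag v)).
  rewrite mem_height_path /in_strip /diag /= addKn eqxx andbT.
  by move: v_strip; rewrite /in_strip; lia.
by rewrite /= {1}/diag /= addKn eqxx.
Qed.

(** Pair the right edge of each vertex with the up edge of the next one.  Both
    join the same two consecutive lines x - y = k and x - y = k + 1, and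
    exactly one of them leaves the path: the up edge after a right step, the
    right edge after a down step. *)
Lemma out_edges_height_path :
  out_edges N (height_path N h) = mkseq (height_out_edge h) N.
Proof.
pose V := height_vertex h.
have regroup n : flatten [seq [:: up_edge v; right_edge v] | v <- mkseq V n.+1] =
    up_edge (V 0%N) ::
      flatten (mkseq (fun k => [:: right_edge (V k); up_edge (V k.+1)]) n) ++
      [:: right_edge (V n)].
  elim: n => [//|n IHn].
  by rewrite mkseqS map_rcons flatten_rcons IHn mkseqS flatten_rcons /= -!catA.
rewrite /out_edges {1}/height_path regroup /= ifF; last first.
  by rewrite /in_strip /= addn0 ltnn.
rewrite filter_cat /= ifF ?cats0; last by rewrite /in_strip /=; lia.
rewrite filter_flatten /mkseq -map_comp -[RHS]flatten_seq1 -map_comp.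
congr flatten; apply/eq_in_map => k; rewrite mem_iota add0n => /andP[_ k_N] /=.
rewrite !mem_height_path /height_out_edge /in_strip /diag /= -/V.
have -> : ((h k + k).+1 - h k = k.+1)%N by lia.
have -> : (h k.+1 + k.+1 - (h k.+1).+1 = k)%N by lia.
case: (h_down k_N) => hk; rewrite hk eqxx /= ?andbF.
  by rewrite ifF ?ifT //; lia.
by rewrite ifT ?ifF //; lia.
Qed.

Lemma height_out_edge_inj : {in gtn N &, injective (height_out_edge h)}.
Proof.
move=> j k /h_down hj /h_down hk; rewrite /height_out_edge /height_vertex.
by do 2 case: eqP => ? []; lia.
Qed.

End Heights.

Lemma scan_between N P Q : pairwise scan_order (between N P Q).
Proof.
rewrite /between; apply: pairwise_filter.
move: (\max_(w <- Q) w.2).+1 N.+1 => m n; move: 0%N => y.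
elim: m y => //= m IHm y; rewrite /= pairwise_cat IHm andbT pairwise_map.
apply/andP; split.
  apply/allrelP => u v /mapP[x _ ->] /allpairsPdep[y' [x' [+ _ ->]]].
  by rewrite mem_iota /scan_order /= => /andP[->].
rewrite (_ : pairwise _ _ = pairwise ltn (iota y n)); last first.
  by apply: eq_pairwise => x x'; rewrite /= /scan_order ltnn eqxx.
by rewrite -sorted_pairwise; [exact: iota_ltn_sorted | exact: ltn_trans].
Qed.

(** On each line x - y = k the translate is exactly one unit higher than the
    path, which leaves no room for other vertices. *)
Lemma mem_between_shift N h :
  between N (height_path N h) (shift 1 (height_path N h)) =i shift 1 (height_path N h).
Proof.
move=> v; rewrite shift_height_path mem_filter.
set Q := height_path N (fun k => (h k).+1).
have [vQ|nvQ] := boolP (v \in Q).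
  have := vQ; rewrite mem_height_path => /andP[v_strip /eqP hv].
  rewrite /strictly_above /weakly_below.
  rewrite (has_height_path _ (fun n => n < v.2)%N) // (has_height_path _ (leq v.2)) //.
  apply/andP; split; first by rewrite hv /= ltnSn.
  apply/allpairsPdep; exists v.2, v.1; split.
  - rewrite mem_iota add0n ltnS /=.
    exact: (@leq_bigmax_seq (nat * nat)%type Q xpredT snd).
  - by move: v_strip; rewrite mem_iota /in_strip addnS ltnS.
  - by case: (v).
apply/negP => /andP[/andP[above below]] /allpairsPdep[y [x [_]]].
rewrite mem_iota => x_y vE; case/negP: nvQ.
have v_strip : in_strip N v by rewrite vE /in_strip /=; lia.
rewrite mem_height_path v_strip /=; move: above below.
rewrite /strictly_above /weakly_below.
rewrite (has_height_path _ (fun n => n < v.2)%N) // (has_height_path _ (leq v.2)) //.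
by rewrite eqn_leq => -> ->.
Qed.

(** * Each arrow read above the path comes from the path or was sampled before *)

(** Let v be the vertex of the translate on the line x - y = k.  If the path
    goes right between the lines k - 1 and k, then the left neighbour of v is on
    the translate; if it goes down, that neighbour is on the path.  For the
    bottom neighbour of v, on the line k + 1, the alternatives are exchanged. *)
Lemma read_edge_source N h v e : down_right_height N h ->
  v \in shift 1 (height_path N h) -> reads N v e ->
  e \in out_edges N (height_path N h) \/
  exists2 u, u \in shift 1 (height_path N h) & e \in [:: right_edge u; up_edge u].
Proof.
move=> h_down; rewrite shift_height_path out_edges_height_path // => /mapP[k].
rewrite mem_iota add0n => /andP[_ k_N] ->.
have memQ j : (j <= N)%N ->
    height_vertex (fun i => (h i).+1) j \in height_path N (fun i => (h i).+1).
  by move=> j_N; rewrite map_f // mem_iota.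
have memP j : (j < N)%N -> height_out_edge h j \in mkseq (height_out_edge h) N.
  by move=> j_N; rewrite map_f // mem_iota.
rewrite /reads /left_bdry /right_bdry /= => /orP[] /andP[/eqP-> bdry].
  case: k k_N bdry => [|k] k_N bdry; first by move: bdry; lia.
  have [flat|fall] := h_down k k_N.
    right; exists (height_vertex (fun i => (h i).+1) k); first exact/memQ/ltnW.
    rewrite inE; apply/orP; left.
    by rewrite /right_edge /left_edge /height_vertex /= flat !addnS addSn.
  left; have := memP k k_N; rewrite /height_out_edge fall gtn_eqF //.
  by rewrite /right_edge /left_edge /height_vertex /= fall !addnS addSn.
have {k_N bdry} k_N : (k < N)%N by move: k_N bdry; rewrite ltnS; lia.
have [flat|fall] := h_down k k_N.
  left; have := memP k k_N; rewrite /height_out_edge flat eqxx.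
  by rewrite /up_edge /bottom_edge /height_vertex /= flat !addnS addSn.
right; exists (height_vertex (fun i => (h i).+1) k.+1); first exact: memQ.
rewrite !inE; apply/orP; right.
by rewrite /up_edge /bottom_edge /height_vertex /= fall !addnS !addSn.
Qed.

(** * The outgoing configuration of a path *)

Section OutEdges.
Variables (N : nat) (P : seq vertex) (h : nat -> nat).
Hypotheses (h_down : down_right_height N h) (P_h : P = height_path N h).

Lemma out_edge_height (i : 'I_N) : out_edge P i = height_out_edge h i.
Proof. by rewrite /out_edge P_h out_edges_height_path // nth_mkseq. Qed.

Lemma out_edge_inj : injective (@out_edge N P).
Proof.
move=> i j; rewrite !out_edge_height => /(height_out_edge_inj h_down) ij.
by apply/val_inj/ij; rewrite inE ltn_ord.
Qed.

Lemma codom_out_edge :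
  [seq out_edge P i | i <- enum 'I_N] = out_edges N P.
Proof.
rewrite P_h out_edges_height_path // /mkseq -val_enum_ord -map_comp -P_h.
by apply: eq_map => i; apply: out_edge_height.
Qed.

Lemma mem_out_edge (i : 'I_N) : out_edge P i \in out_edges N P.
Proof. by rewrite -codom_out_edge map_f ?mem_enum. Qed.

Lemma product_measure_edge_prob (R : realFieldType) (pup pright : R)
    (tau : out_config N) :
  product_measure pup pright P tau =
  \prod_(i < N) bernoulli (edge_prob N pup pright (out_edge P i)) (tau i).
Proof.
apply: eq_bigr => i _; rewrite /edge_prob.
by have := mem_out_edge i; rewrite mem_filter => /andP[/andP[-> _] _].
Qed.

Lemma has_out_config_init (tau tau' : out_config N) :
  has_out_config P tau' (init_arrows P tau) = (tau == tau').
Proof.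
have initE (t : out_config N) i : init_arrows P t (out_edge P i) = t i.
  apply/existsP/idP => [[j /andP[/eqP/out_edge_inj <-]] //|t_i].
  by exists i; rewrite eqxx.
apply/forallP/eqP => [eq_tau|-> i]; last by rewrite initE.
by apply/ffunP => i; rewrite -(initE tau) (eqP (eq_tau i)).
Qed.

Lemma indep_has_out_config (R : realFieldType) (tau : out_config N) e :
  e \notin out_edges N P -> indep e (fun w => (has_out_config P tau w)%:R : R).
Proof.
move=> neP w x; congr (nat_of_bool _)%:R; apply: eq_forallb => i.
rewrite /set_edge; have [ei|//] := eqVneq (out_edge P i) e.
by rewrite -ei mem_out_edge in neP.
Qed.

End OutEdges.

(** * Stationarity of the product measure *)

Section Stationarity.
Variables (R : realFieldType) (N : nat) (a b c d theta1 theta2 pup pright : R).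
Hypothesis N_gt0 : (0 < N)%N.
Hypothesis bulk_balance :
  (1 - theta1) * (pup * (1 - pright)) = (1 - theta2) * (pright * (1 - pup)).
Hypothesis left_balance : pright = pup * (1 - c) + (1 - pup) * a.
Hypothesis right_balance : pup = pright * (1 - b) + (1 - pright) * d.
Variable P : seq vertex.
Hypothesis P_path : down_right_path N P.

Lemma product_measure_invariant (tau' : out_config N) :
  \sum_(tau : out_config N) product_measure pup pright P tau *
     transition a b c d theta1 theta2 P (shift 1 P) tau tau' =
  product_measure pup pright P tau'.
Proof.
have [h h_down P_h] := down_right_path_height P_path.
set Q := shift 1 P; pose h1 := fun k => (h k).+1.
have Q_h : Q = height_path N h1 by rewrite /Q P_h shift_height_path.
have h1_down : down_right_height N h1.
  by move=> k /h_down[]; rewrite /h1 => ->; [left|right].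
(* Translating a path does not change the directions of its outgoing edges. *)
have sameQ (tau : out_config N) :
    product_measure pup pright P tau = product_measure pup pright Q tau.
  apply: eq_bigr => i _.
  rewrite (out_edge_height h_down P_h) (out_edge_height h1_down Q_h).
  by rewrite /height_out_edge eqSS; case: eqP.
pose prob := edge_prob N pup pright.
pose vs := between N P Q.
have vsQ : vs =i Q by move=> v; rewrite /vs /Q P_h mem_between_shift.
have vs_order : pairwise scan_order vs := scan_between N P Q.
pose A w : R := (has_out_config Q tau' w)%:R.
pose G w := prob_after N a b c d theta1 theta2 vs w (has_out_config Q tau').
pose around v := [:: left_edge v; bottom_edge v; right_edge v; up_edge v].
pose L := out_edges N P ++ flatten [seq around v | v <- Q].
have indA e : e.2 \in Q -> indep e A.
  move=> eQ; apply: (indep_has_out_config h1_down Q_h).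
  by rewrite mem_filter eQ andbF.
have written u e : u \in Q -> e \in [:: right_edge u; up_edge u] -> indep e G.
  by rewrite -vsQ; apply: indep_prob_written.
(* Either e is read, hence written beforehand, or it leaves Q and is written,
   or it ends on Q, where A does not look, and is never read. *)
have indG e : e \in L -> e \notin out_edges N P -> indep e G.
  rewrite mem_cat => /orP[-> //|/flatten_mapP[v vQ e_v] neP].
  have [/hasP[u uQ e_u]|/hasPn unread] := boolP (has (fun u => reads N u e) vs).
    have uQ' : u \in shift 1 (height_path N h) by rewrite -P_h -vsQ.
    have [|[u' u'Q e_u']] := read_edge_source h_down uQ' e_u.
      by rewrite -P_h (negbTE neP).
    by apply: written e_u'; rewrite /Q P_h.
  have [/(written v e vQ) //|ne_out] := boolP (e \in [:: right_edge v; up_edge v]).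
  apply: indep_prob_unread => //; apply: indA.
  move: e_v ne_out; rewrite !inE orbA => /orP[|->//].
  by case/orP => /eqP -> _.
transitivity (average_seq prob (out_edges N P) G (fun=> false)).
  rewrite -(codom_out_edge h_down P_h) -sum_init_arrows; last exact: out_edge_inj P_h.
  by apply: eq_bigr => tau _; rewrite (product_measure_edge_prob h_down P_h).
have subL v : v \in Q -> {subset around v <= L}.
  by move=> vQ e ev; rewrite mem_cat; apply/orP; right; apply/flatten_mapP; exists v.
have -> : average_seq prob (out_edges N P) G = average_seq prob L G.
  by apply: eq_average_seq => e eL; [rewrite mem_cat eL|apply: indG].
have -> : average_seq prob L G = average_seq prob L A.
  apply: average_seq_prob => // [v|v||e]; rewrite ?vsQ.
  - by rewrite Q_h mem_height_path => /andP[-> /eqP->].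
  - exact: subL.
  - by apply: pairwise_uniq vs_order; apply: scan_order_irr.
  - exact: indA.
have -> : average_seq prob L A = average_seq prob (out_edges N Q) A.
  apply: eq_average_seq => e.
    by move=> _; apply: (indep_has_out_config h1_down Q_h).
  rewrite mem_filter => /andP[_ /flatten_mapP[v vQ ev]] /negP[]; apply: subL vQ _ _.
  by move: ev; rewrite !inE => /orP[->|->]; rewrite ?orbT.
rewrite -(codom_out_edge h1_down Q_h) -sum_init_arrows; last exact: out_edge_inj Q_h.
rewrite sameQ (product_measure_edge_prob h1_down Q_h).
rewrite (bigD1 tau') //= [X in _ + X]big1 => [|tau ne]; last first.
  by rewrite /A (has_out_config_init h1_down Q_h) (negbTE ne) mulr0.
by rewrite /A (has_out_config_init h1_down Q_h) eqxx mulr1 addr0.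
Qed.

Lemma product_measure_stationary : 0 <= pup <= 1 -> 0 <= pright <= 1 ->
  six_vertex_stationary a b c d theta1 theta2 P (@product_measure R N pup pright P).
Proof.
move=> /andP[pup0 pup1] /andP[pright0 pright1]; split=> [tau||tau'].
- by apply: prodr_ge0 => i _; case: ifP; case: (tau i); rewrite //= subr_ge0.
- exact: sum_prod_bernoulli.
- exact: product_measure_invariant.
Qed.

End Stationarity.

Theorem corollary2p11 (R : realFieldType) (N : nat)
    (a b c d theta1 theta2 : R) (P : seq vertex) :
  (1 <= N)%N ->
  0 <= a <= 1 -> 0 <= b <= 1 -> 0 <= c <= 1 -> 0 <= d <= 1 ->
  0 <= theta1 <= 1 -> 0 <= theta2 <= 1 ->
  (1 - theta1) * (a + d - a * b - a * d) * (b + c - b * c - a * b) =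
  (1 - theta2) * (a + d - a * d - c * d) * (b + c - b * c - c * d) ->
  (1 - theta1) * (a + d - a * b - a * d) * (b + c - b * c - a * b) != 0 ->
  (1 - theta2) * (a + d - a * d - c * d) * (b + c - b * c - c * d) != 0 ->
  down_right_path N P ->
  let den := a + b + c + d - (a + c) * (b + d) in
  let pup := (a + d - a * b - a * d) / den in
  let pright := (a + d - a * d - c * d) / den in
  six_vertex_stationary a b c d theta1 theta2 P
    (@product_measure R N pup pright P).
Proof.
move=> N_gt0 /andP[a0 a1] /andP[b0 b1] /andP[c0 c1] /andP[d0 d1] _ _.
move=> balance nz1 _ P_path den pup pright.
have Eup : a + d - a * b - a * d = a * (1 - b) + d * (1 - a) by ring.
have Eright : a + d - a * d - c * d = a * (1 - d) + d * (1 - c) by ring.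
have Edown : b + c - b * c - c * d = b * (1 - c) + c * (1 - d) by ring.
have Eleft : b + c - b * c - a * b = b * (1 - a) + c * (1 - b) by ring.
have pos (x y : R) : 0 <= x -> y <= 1 -> 0 <= x * (1 - y).
  by move=> x0 y1; rewrite mulr_ge0 ?subr_ge0.
have den_up : den = (a + d - a * b - a * d) + (b + c - b * c - c * d).
  by rewrite /den; ring.
have den_right : den = (a + d - a * d - c * d) + (b + c - b * c - a * b).
  by rewrite /den; ring.
have up_ge0 : 0 <= a + d - a * b - a * d by rewrite Eup addr_ge0 ?pos.
have right_ge0 : 0 <= a + d - a * d - c * d by rewrite Eright addr_ge0 ?pos.
have down_ge0 : 0 <= b + c - b * c - c * d by rewrite Edown addr_ge0 ?pos.
have left_ge0 : 0 <= b + c - b * c - a * b by rewrite Eleft addr_ge0 ?pos.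
(* The denominator is the sum of two nonnegative numbers, one of which is
   nonzero as a factor of the common value of the two sides. *)
have den_gt0 : 0 < den.
  rewrite den_up ltr_pwDl // lt_def up_ge0 andbT.
  by apply: contra_neq nz1 => ->; rewrite mulr0 mul0r.
have den_neq0 : den != 0 by rewrite gt_eqF.
have pupC : 1 - pup = (b + c - b * c - c * d) / den.
  by apply: (mulIf den_neq0); rewrite mulrBl !divfK // den_up; ring.
have prightC : 1 - pright = (b + c - b * c - a * b) / den.
  by apply: (mulIf den_neq0); rewrite mulrBl !divfK // den_right; ring.
apply: product_measure_stationary => //.
- transitivity ((1 - theta1) * (a + d - a * b - a * d) *
    (b + c - b * c - a * b) / den ^+ 2); first by rewrite prightC /pup; field.
  by rewrite balance pupC /pright; field.
- by rewrite pupC /pup /pright; field.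
- by rewrite prightC /pup /pright; field.
- by rewrite -[_ <= 1]subr_ge0 pupC !divr_ge0 // ltW.
- by rewrite -[_ <= 1]subr_ge0 prightC !divr_ge0 // ltW.
Qed.
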